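(* Let $K$ be a field with an ordering $<$ such that each positive element of $K$ is a square in $K$. Let $L:=K(i)$ with $i^2=-1$, and let $\sigma:L\to L$ be the $K$-automorphism induced by $i\mapsto -i$. Let $n\ge 1$ and let $M\in M_{n,n}(L)$ be such that $M=M^\dagger$. Then $\mathrm{Num}(M)$ is $\Delta$-convex.
   Context: $M_{n,n}(L)$ is the set of $n\times n$ matrices over $L$. For $M=(m_{ij})$, $M^\dagger:=(\sigma(m_{ji}))$ is the $\sigma$-conjugate transpose. For $u,v\in L^n$ set $\langle u,v\rangle:=\sum_{i=1}^n\sigma(u_i)v_i$. The numerical range of $M\in M_{n,n}(L)$ is $\mathrm{Num}(M):=\{\langle u,Mu\rangle \mid u\in L^n,\ \langle u,u\rangle=1\}\subseteq L$. $\Delta:=\{a\sigma(a)\mid a\in L\}\subseteq K$ and $1-\Delta:=\{1-s\mid s\in\Delta\}$. A set $S\subseteq L$ is $\Delta$-convex if for all $a,b\in S$ with $a\ne b$ it contains all elements $ta+(1-t)b$ with $t\in\Delta\cap(1-\Delta)$. *)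

(* Defs.v *)
From mathcomp Require Import all_boot all_order all_algebra.
From mathcomp Require Import complex.
From mathcomp Require Import classical_sets.
Set Implicit Arguments.
Unset Strict Implicit.
Unset Printing Implicit Defensive.
Import GRing.Theory.
Local Open Scope ring_scope.
Local Open Scope complex_scope.
Local Open Scope classical_set_scope.

Section NumericalRange.
Variable K : realFieldType.

Definition conj_trmx (m n : nat) (A : 'M[K[i]]_(m, n)) : 'M[K[i]]_(n, m) :=
  map_mx (@conjc K) A^T.

Definition dotc (n : nat) (u v : 'cV[K[i]]_n) : K[i] :=
  \sum_(j < n) conjc (u j 0) * v j 0.

Definition Num_range (n : nat) (M : 'M[K[i]]_n) : set K[i] :=
  [set dotc u (M *m u) | u in [set u : 'cV[K[i]]_n | dotc u u = 1]].

(* [Delta] is a subset of K; the norms [a * conjc a] live in K[i], so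
   membership is expressed through the embedding K -> K[i]. *)
Definition Delta : set K :=
  [set s | exists a : K[i], s%:C = a * conjc a].

Definition one_sub_Delta : set K := [set 1 - s | s in Delta].

Definition Delta_convex (S : set K[i]) : Prop :=
  forall a b, S a -> S b -> a <> b ->
  forall t, (Delta `&` one_sub_Delta) t -> S (t%:C * a + (1 - t%:C) * b).

End NumericalRange.

(* Main.v *)
(* For s = t a + (1 - t) b the Hermitian form w |-> <w, M w> - s <w, w> takes the
   real values (1 - t)(a - b) and -t (a - b) at the unit vectors representing a
   and b.  These have opposite signs (or one vanishes), so on real combinations
   of the two vectors the form is an indefinite binary quadratic form, which has
   a nontrivial zero because its discriminant is nonnegative, hence a square.
   The zero is a nonzero vector since a != b makes the two vectors independent,
   and normalizing it, which needs a square root of <w, w> > 0, represents s. *)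
Require Import Defs.
From mathcomp Require Import all_boot all_order all_algebra.
From mathcomp Require Import complex.
From mathcomp Require Import ring lra.
Set Implicit Arguments.
Unset Strict Implicit.
Unset Printing Implicit Defensive.
Import Order.TTheory GRing.Theory Num.Theory.
Local Open Scope ring_scope.
Local Open Scope complex_scope.

(* [complex.v] proves the ring morphism laws of [conjc] only over an [rcfType]. *)
Section Conjugation.
Variable K : realFieldType.
Implicit Types (z : K[i]) (x : K).

Lemma conjcD z1 z2 : conjc (z1 + z2) = conjc z1 + conjc z2.
Proof. by case: z1 z2 => [a b] [c d] /=; rewrite opprD. Qed.

Lemma conjcM z1 z2 : conjc (z1 * z2) = conjc z1 * conjc z2.
Proof.
case: z1 z2 => [a b] [c d]; apply/eqP.
by rewrite eq_complex /=; apply/andP; split; apply/eqP; ring.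
Qed.

Lemma conjcR x : conjc x%:C = x%:C.
Proof. by rewrite /= oppr0. Qed.

Lemma conjc_conjc z : conjc (conjc z) = z.
Proof. by case: z => [a b] /=; rewrite opprK. Qed.

Lemma conjc_sum (I : finType) (F : I -> K[i]) :
  conjc (\sum_i F i) = \sum_i conjc (F i).
Proof. exact: (big_morph _ conjcD (conjcR 0)). Qed.

Lemma addc_conj z : z + conjc z = (complex.Re z *+ 2)%:C.
Proof. by case: z => [a b]; apply/eqP; rewrite eq_complex /= subrr !eqxx. Qed.

Lemma conjc_fixed z : conjc z = z -> z = (complex.Re z)%:C.
Proof. by case: z => [a b] /= [] b0; congr (_ +i* _); lra. Qed.

Lemma mulc_conj z : conjc z * z = (complex.Re z ^+ 2 + complex.Im z ^+ 2)%:C.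
Proof.
case: z => [a b]; apply/eqP.
by rewrite eq_complex /=; apply/andP; split; apply/eqP; ring.
Qed.

(** A norm is a sum of two squares. Used for both [t] and [1 - t], this confines [t] to the interval
    from 0 to 1. *)
Lemma Delta_ge0 x : Delta x -> 0 <= x.
Proof.
case=> z; rewrite mulrC mulc_conj => - [->].
by rewrite addr_ge0 ?sqr_ge0.
Qed.

End Conjugation.

Section HermitianForm.
Variables (K : realFieldType) (n : nat).
Implicit Types (u v w : 'cV[K[i]]_n) (A M : 'M[K[i]]_n) (c : K[i]) (x y : K).

Lemma dotcDl u v w : dotc (u + v) w = dotc u w + dotc v w.
Proof.
rewrite /dotc -big_split /=; apply: eq_bigr => j _.
by rewrite mxE conjcD mulrDl.
Qed.

Lemma dotcDr u v w : dotc w (u + v) = dotc w u + dotc w v.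
Proof. by rewrite /dotc -big_split /=; apply: eq_bigr => j _; rewrite mxE mulrDr. Qed.

Lemma dotcZl c u v : dotc (c *: u) v = conjc c * dotc u v.
Proof.
by rewrite /dotc mulr_sumr; apply: eq_bigr => j _; rewrite mxE conjcM mulrA.
Qed.

Lemma dotcZr c u v : dotc u (c *: v) = c * dotc u v.
Proof.
by rewrite /dotc mulr_sumr; apply: eq_bigr => j _; rewrite mxE mulrCA.
Qed.

Lemma conjc_dotc u v : conjc (dotc u v) = dotc v u.
Proof.
rewrite /dotc conjc_sum; apply: eq_bigr => j _.
by rewrite conjcM conjc_conjc mulrC.
Qed.

Lemma dotc_mulmxr A u v : dotc u (A *m v) = dotc (conj_trmx A *m u) v.
Proof.
under [LHS]eq_bigr => j _ do rewrite mxE mulr_sumr.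
rewrite exchange_big /=; apply: eq_bigr => k _.
rewrite mxE conjc_sum mulr_suml; apply: eq_bigr => j _.
by rewrite !mxE conjcM conjc_conjc mulrA [conjc _ * _]mulrC.
Qed.

Lemma conjc_dotc_herm A u v : A = conj_trmx A ->
  conjc (dotc u (A *m v)) = dotc v (A *m u).
Proof. by move=> hA; rewrite conjc_dotc [RHS]dotc_mulmxr -hA. Qed.

(** This lets the lemmas on Hermitian forms apply to [dotc] itself, as the case [A = 1%:M]. *)
Lemma conj_trmx1 : (1%:M : 'M[K[i]]_n) = conj_trmx 1%:M.
Proof.
apply/matrixP => i j; rewrite !mxE eq_sym.
by case: (_ == _); rewrite conjcR.
Qed.

Lemma dotc_herm_real A u : A = conj_trmx A ->
  dotc u (A *m u) = (complex.Re (dotc u (A *m u)))%:C.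
Proof. by move=> hA; apply: conjc_fixed; rewrite conjc_dotc_herm. Qed.

(** Since [x] and [y] are real, the two cross terms are conjugate to each other and add up to twice
    a real part. *)
Lemma dotc_herm_comb A u v x y : A = conj_trmx A ->
  dotc (x%:C *: u + y%:C *: v) (A *m (x%:C *: u + y%:C *: v)) =
  (x ^+ 2 * complex.Re (dotc u (A *m u)) + y ^+ 2 * complex.Re (dotc v (A *m v))
    + x * y * (complex.Re (dotc u (A *m v)) *+ 2))%:C.
Proof.
move=> hA; rewrite !mulmxDr -!scalemxAr !(dotcDl, dotcDr, dotcZl, dotcZr) !conjcR.
rewrite -(conjc_dotc_herm u v hA).
rewrite [RHS]rmorphD [X in _ = _ + X]rmorphM /= -addc_conj !(rmorphD, rmorphM, rmorphXn) /=.
rewrite -!dotc_herm_real //.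
ring.
Qed.

Lemma dotc_gt0 u : u != 0 -> exists2 r : K, 0 < r & dotc u u = r%:C.
Proof.
move=> /cV0Pn [k uk].
exists (\sum_j (complex.Re (u j 0) ^+ 2 + complex.Im (u j 0) ^+ 2)); last first.
  by rewrite rmorph_sum; apply: eq_bigr => j _; rewrite mulc_conj.
have ge0 j : 0 <= complex.Re (u j 0) ^+ 2 + complex.Im (u j 0) ^+ 2.
  by rewrite addr_ge0 ?sqr_ge0.
rewrite (bigD1 k) //= ltr_pwDl ?sumr_ge0 // lt_def ge0 andbT.
by move: uk; rewrite eq_complex paddr_eq0 ?sqr_ge0 // !expf_eq0.
Qed.

(** Dividing [w] by a square root [k] of [dotc w w] gives a unit vector; as [k] is real, both forms
    are divided by [k ^+ 2]. *)
Lemma Num_range_isotropic M w (s : K[i]) :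
  (forall x : K, 0 < x -> exists y : K, x = y ^+ 2) ->
  w != 0 -> dotc w (M *m w) = s * dotc w w -> Num_range M s.
Proof.
move=> pos_square /dotc_gt0 [r r0 rE] qE.
have [k kE] := pos_square r r0.
have k0 : k%:C != 0 :> K[i].
  by rewrite fmorph_eq0; apply: contraTneq r0 => k0; rewrite kE k0 expr0n ltxx.
have rk : dotc w w = k%:C * k%:C by rewrite rE kE -rmorphM expr2.
exists (k^-1%:C *: w); rewrite /= -?scalemxAr dotcZl dotcZr conjcR ?qE rk fmorphV /=.
  by field.
by field.
Qed.

End HermitianForm.

Lemma binary_form_isotropic (K : realFieldType) (a b c : K) :
  (forall x : K, 0 < x -> exists y : K, x = y ^+ 2) -> a * c <= 0 ->
  exists x y : K, (x, y) != (0, 0) /\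
    x ^+ 2 * a + y ^+ 2 * c + x * y * (b *+ 2) = 0.
Proof.
move=> pos_square ac_le0; have [->|a0] := eqVneq a 0.
  by exists 1, 0; split; [rewrite xpair_eqE oner_eq0 | ring].
have [k kE] : exists k, b ^+ 2 - a * c = k ^+ 2.
  have : 0 <= b ^+ 2 - a * c by rewrite subr_ge0 (le_trans ac_le0) ?sqr_ge0.
  rewrite le_eqVlt => /orP[/eqP <-|/pos_square //].
  by exists 0; rewrite expr0n.
(* With [y = 1] this is the quadratic formula for [a x^2 + 2 b x + c], where [k ^+ 2] is a quarter
   of the discriminant. *)
exists ((k - b) / a), 1; split; first by rewrite xpair_eqE oner_eq0 andbF.
have -> : c = (b ^+ 2 - k ^+ 2) / a by rewrite -kE; field.
by field.
Qed.

Theorem proposition1 (K : realFieldType)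
    (pos_square : forall x : K, 0 < x -> exists y : K, x = y ^+ 2)
    (n : nat) (n_gt0 : (0 < n)%N)
    (M : 'M[K[i]]_n) (M_herm : M = conj_trmx M) :
  Delta_convex (Num_range M).
Proof.
move=> _ _ [u /= u1 <-] [v /= v1 <-] + t [/Delta_ge0 t0 [t' /Delta_ge0 t'0 tE]].
rewrite (dotc_herm_real u M_herm) (dotc_herm_real v M_herm).
set a := complex.Re (dotc u _); set b := complex.Re (dotc v _) => ab.
set p := complex.Re (dotc u (M *m v)).
have I_herm := conj_trmx1 K n.
set q := complex.Re (dotc u (1%:M *m v)).
pose s := t * a + (1 - t) * b.
(* These are the coefficients, on real combinations of [u] and [v], of the form of [M] minus [s]
   times that of the identity. *)
have [|x [y [xy0 iso]]] := @binary_form_isotropic K (a - s) (p - s * q) (b - s) pos_square.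
  (* Here [t' = 1 - t], so the factors are [t' * (a - b)] and [- t * (a - b)]. *)
  have -> : (a - s) * (b - s) = - (t * t' * (a - b) ^+ 2) by rewrite /s -tE; ring.
  by rewrite oppr_le0 mulr_ge0 ?sqr_ge0 // mulr_ge0.
pose w := x%:C *: u + y%:C *: v.
have wMw : dotc w (M *m w) = (x ^+ 2 * a + y ^+ 2 * b + x * y * (p *+ 2))%:C.
  exact: dotc_herm_comb.
have ww : dotc w w = (x ^+ 2 + y ^+ 2 + x * y * (q *+ 2))%:C.
  by rewrite -[X in dotc _ X]mul1mx dotc_herm_comb // /q !mul1mx u1 v1 /= !mulr1.
have -> : t%:C * a%:C + (1 - t%:C) * b%:C = s%:C.
  by rewrite /s rmorphD !rmorphM rmorphB rmorph1.
apply: (@Num_range_isotropic K n M w) => //; last first.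
  rewrite wMw ww -rmorphM; congr (_%:C).
  by apply: subr0_eq; rewrite -[RHS]iso; ring.
(* If [w = 0], then [x u = - y v], and every Hermitian form agrees on the two sides. The identity
   gives [x ^+ 2 = y ^+ 2], then [M] gives [x ^+ 2 * (a - b) = 0], so [x = y = 0] because [a] and
   [b] differ. *)
apply: contraNneq xy0 => /eqP; rewrite addr_eq0 -scaleNr -rmorphN => /eqP xu.
have form_eq A : A = conj_trmx A ->
    x ^+ 2 * complex.Re (dotc u (A *m u)) = y ^+ 2 * complex.Re (dotc v (A *m v)).
  move=> hA; have := congr1 (fun z => dotc z (A *m z)) xu.
  rewrite -!scalemxAr !(dotcZl, dotcZr) !conjcR.
  rewrite (dotc_herm_real u hA) (dotc_herm_real v hA) -!rmorphM => - [].
  by rewrite !mulrA !mulrNN -!expr2.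
have := form_eq _ I_herm; rewrite !mul1mx u1 v1 /= !mulr1 => xy.
have := form_eq _ M_herm; rewrite -/a -/b -xy => /eqP.
rewrite -subr_eq0 -mulrBr mulf_eq0 subr_eq0 => /orP[/eqP x0|/eqP ab_eq].
  by rewrite xpair_eqE -(sqrf_eq0 x) -(sqrf_eq0 y) -xy x0 eqxx.
by case: ab; rewrite ab_eq.
Qed.
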